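(* Let $G$ be a connected ELC-preserved $(r,k-r)$-bipartite graph on $k\ge 2$ vertices. Then the Hamming expansion $H(G)$ corresponds to a $[7k,\,3k+r,\,4]$ code $\mathcal{C}$ and to the dual $[7k,\,4k-r,\,4]$ code $\mathcal{C}^\perp$.
   Context: All graphs are finite, simple and undirected. For a graph $G=(V,E)$ and $v\in V$, $N_v$ is the set of vertices adjacent to $v$. Local complementation (LC) on $v$ transforms $G$ into $G*v$ by replacing the induced subgraph of $G$ on $N_v$ by its complement. For an edge $\{u,v\}\in E$, edge local complementation (ELC) on $\{u,v\}$ transforms $G$ into $G^{(u,v)}=G*u*v*u=G*v*u*v$ (operations applied from left to right). $G$ is ELC-preserved if for every edge $\{u,v\}\in E$, $G^{(u,v)}$ is isomorphic to $G$. An $(a,b)$-bipartite graph is a bipartite graph whose two partitions (independent sets decomposing the vertex set) have sizes $a$ and $b$. Hamming expansion: let $G=(V,E)$ with $V=\{v_0,\dots,v_{k-1}\}$. $H(G)$ is the graph on the $7k$ vertices $w_0,\dots,w_{7k-1}$ constructed as follows. For each $0\le i<k$, the vertex $v_i$ is replaced by the subgraph $h_i$ with vertices $\{w_{7i},\dots,w_{7i+6}\}$ and edges $\{w_{7i},w_{7i+3}\}$, $\{w_{7i},w_{7i+4}\}$, $\{w_{7i+1},w_{7i+3}\}$, $\{w_{7i+1},w_{7i+5}\}$, $\{w_{7i+2},w_{7i+4}\}$, $\{w_{7i+2},w_{7i+5}\}$, $\{w_{7i+3},w_{7i+6}\}$, $\{w_{7i+4},w_{7i+6}\}$, $\{w_{7i+5},w_{7i+6}\}$.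 If $\{v_i,v_j\}\in E$, each of $w_{7i},w_{7i+1},w_{7i+2}$ is joined to all of $w_{7j},w_{7j+1},w_{7j+2}$. There are no other edges. An $[n,k,d]$ code is a $k$-dimensional subspace of $\mathbb{F}_2^n$ with minimum distance $d$; two codes are equivalent if one is obtained from the other by a permutation of coordinates; $\mathcal{C}^\perp$ is the dual with respect to the standard inner product. A bipartite graph corresponds to an $[n,k]$ code $\mathcal{C}$ if it is isomorphic to the $(k,n-k)$-bipartite graph with adjacency matrix $\begin{pmatrix}\mathbf{0}_{k\times k}&P\\P^{\mathrm T}&\mathbf{0}_{(n-k)\times(n-k)}\end{pmatrix}$ for some generator matrix $(I\mid P)$ of a code equivalent to $\mathcal{C}$. (Up to isomorphism, the same graph then also corresponds to the dual code $\mathcal{C}^\perp$, generated up to equivalence by $(P^{\mathrm T}\mid I)$.) *)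

(* Defs.v *)
From mathcomp Require Import all_boot perm all_algebra.

Set Implicit Arguments.
Unset Strict Implicit.
Unset Printing Implicit Defensive.

Import GRing.Theory.

Record sgraph (T : finType) := SGraph {
  edge :> rel T;
  edge_sym : symmetric edge;
  edge_irr : irreflexive edge }.

Section Graphs.
Variable T : finType.
Implicit Types (G : sgraph T) (A : {set T}).

Definition lc_rel G (v : T) : rel T := fun x y =>
  if [&& x != y, G v x & G v y] then ~~ G x y else G x y.

Fact lc_sym G v : symmetric (lc_rel G v).
Proof.
by move=> x y; rewrite /lc_rel eq_sym (edge_sym G x) [G v x && _]andbC.
Qed.

Fact lc_irr G v : irreflexive (lc_rel G v).
Proof. by move=> x; rewrite /lc_rel eqxx edge_irr. Qed.

Definition lc G v : sgraph T := SGraph (lc_sym G v) (@lc_irr G v).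

Definition elc G (u v : T) : sgraph T := lc (lc (lc G u) v) u.

Definition connected_graph G := forall x y : T, connect G x y.

Definition independent G A := forall x y, x \in A -> y \in A -> ~~ G x y.

Definition bipartite G (a b : nat) := exists A : {set T},
  [/\ #|A| = a, #|~: A| = b, independent G A & independent G (~: A)].

End Graphs.

Definition isomorphic (T U : finType) (G : sgraph T) (H : sgraph U) :=
  exists2 f : T -> U, bijective f & forall x y, H (f x) (f y) = G x y.

Definition elc_preserved (T : finType) (G : sgraph T) :=
  forall u v : T, G u v -> isomorphic (elc G u v) G.

Definition h_edges : seq (nat * nat) :=
  [:: (0, 3); (0, 4); (1, 3); (1, 5); (2, 4); (2, 5); (3, 6); (4, 6); (5, 6)].

Definition h_rel : rel nat := fun a b =>
  ((a, b) \in h_edges) || ((b, a) \in h_edges).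

Section HammingExpansion.
Variable k : nat.

Fact block_subproof (x : 'I_(7 * k)) : x %/ 7 < k.
Proof. by rewrite ltn_divLR // (leq_trans (ltn_ord x)) // mulnC. Qed.

(* The vertex w_(7i+a), with i < k and a < 7, is the ordinal 7i + a;
   [block] recovers i and [offset] recovers a. *)
Definition block (x : 'I_(7 * k)) : 'I_k := Ordinal (block_subproof x).
Definition offset (x : 'I_(7 * k)) : nat := x %% 7.

Variable G : sgraph 'I_k.

Definition hamming_rel : rel 'I_(7 * k) := fun x y =>
  if block x == block y then h_rel (offset x) (offset y)
  else [&& G (block x) (block y), offset x < 3 & offset y < 3].

Fact hamming_sym : symmetric hamming_rel.
Proof.
move=> x y; rewrite /hamming_rel eq_sym (edge_sym G) /h_rel orbC.
by rewrite [(offset x < 3) && _]andbC.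
Qed.

Fact hamming_irr : irreflexive hamming_rel.
Proof.
move=> x; rewrite /hamming_rel eqxx /offset.
by have := ltn_pmod x (isT : 0 < 7); case: (x %% 7) => [|[|[|[|[|[|[|]]]]]]].
Qed.

Definition hamming_expansion : sgraph 'I_(7 * k) :=
  SGraph hamming_sym hamming_irr.

End HammingExpansion.

Local Open Scope ring_scope.

Section Codes.
Variable n : nat.
Implicit Types C D : {vspace 'rV['F_2]_n}.

Definition hdist (x y : 'rV['F_2]_n) : nat := #|[set i | x 0 i != y 0 i]|.

Definition min_distance C (d : nat) :=
  (exists x y, [/\ x \in C, y \in C, x != y & hdist x y = d]) /\
  (forall x y, x \in C -> y \in C -> x != y -> (d <= hdist x y)%N).

(* C is an [n, k, d] code *)
Definition is_code C (k d : nat) := \dim C = k /\ min_distance C d.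

Definition equiv_code C D :=
  exists s : 'S_n, forall x, (x \in C) = (col_perm s x \in D).

Definition dual_code C : {vspace 'rV['F_2]_n} :=
  (\bigcap_(x | x \in C) lker (linfun (mulmxr x^T : 'rV_n -> 'M_1)))%VS.

Lemma mem_dual_code C (y : 'rV_n) :
  reflect (forall x, x \in C -> y *m x^T = 0) (y \in dual_code C).
Proof.
rewrite memvE; apply: (iffP subv_bigcapP) => yC x /yC.
  by rewrite -memvE memv_ker lfunE => /eqP.
by move=> yx0; rewrite -memvE memv_ker lfunE /= yx0.
Qed.

Definition generator_matrix k (M : 'M['F_2]_(k, n)) C :=
  basis_of C [seq row i M | i <- enum 'I_k].

End Codes.

Section BipartiteGraph.
Variables (k m : nat) (P : 'M['F_2]_(k, m)).

Definition bip_rel : rel 'I_(k + m) := fun x y =>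
  block_mx 0 P P^T 0 x y == 1.

Fact bip_sym : symmetric bip_rel.
Proof.
move=> x y; rewrite /bip_rel.
have /matrixP/(_ x y) : (block_mx 0 P P^T 0)^T = block_mx 0 P P^T 0.
  by rewrite tr_block_mx !trmx0 trmxK.
by rewrite mxE => <-.
Qed.

Fact bip_irr : irreflexive bip_rel.
Proof.
move=> x; rewrite /bip_rel; case: (splitP x) => j xj.
  have -> : x = lshift m j by apply: val_inj.
  by rewrite block_mxEul mxE.
have -> : x = rshift k j by apply: val_inj.
by rewrite block_mxEdr mxE.
Qed.

Definition bipartite_graph : sgraph 'I_(k + m) := SGraph bip_sym bip_irr.

End BipartiteGraph.

(* [castmx] only identifies the length k + m of the rows of (I | P) with the
   length n of the code; [generator_matrix] forces k to be the dimension. *)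
Definition corresponds (T : finType) (G : sgraph T)
    n (C : {vspace 'rV['F_2]_n}) :=
  exists (k m : nat) (kmn : (k + m)%N = n)
         (P : 'M['F_2]_(k, m)) (D : {vspace 'rV['F_2]_n}),
  [/\ equiv_code C D,
      generator_matrix (castmx (erefl k, kmn) (row_mx 1%:M P)) D
    & isomorphic G (bipartite_graph P)].

(* Main.v *)
Require Import Defs.
From mathcomp Require Import all_boot perm all_algebra.
From mathcomp Require Import zify.
Import GRing.Theory.

(** A connected graph on at least two vertices has no isolated vertex, and this
is what makes the minimum distance equal to 4.

Any bipartite graph H with sides X and ~: X carries the binary code spanned by
the indicator words of the closed neighbourhoods of the vertices of X. Up to a
permutation of the coordinates that puts X first, these words are the rows of a
matrix (I | P), so the code has dimension #|X| and H corresponds to it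
([graph_code_corresponds]). Its words are those w such that w(y) is the sum of
w over the neighbours of y, for every y outside X ([graph_codeP]). The same
equations at the vertices of X say that w is orthogonal to the generators, so
the dual code is the code of the other side ([dual_graph_code]).

Let A and ~: A be the sides of G. The expansion is bipartite: for a block over
a vertex of A the offsets 0, 1, 2, 6 go to the side X = [hside A], for the other
blocks the offsets 3, 4, 5 do, whence #|X| = 4 #|A| + 3 #|~: A|. The complement of
[hside A] is [hside (~: A)], so one statement about an arbitrary side A covers
both the code and its dual.

Take a word w of the code of [hside A], and let t(i) be the sum of its bits at
the offsets 0, 1, 2 of block i, and s(i) the sum of t over the neighbours of i.
Over i in A the three checks of the block are those of the [7,4,3] Hamming code,
where a nonzero word has weight at least 3, and weight 4 or 7 unless t(i) = 1
([hamming_block_weight]). Over i outside A the four checks define the coset of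
the [7,3,4] simplex code by s(i) times the word 1110000; this coset has minimum
weight 3 if s(i) = 1 ([simplex_block_weight]). Call p(i) the bit t(i) or s(i) that
is relevant to block i. A nonzero block with p(i) = 0 already weighs 4. A block
with p(i) = 1 weighs at least 3, and never comes alone. If s(i) = 1, some neighbour j has
t(j) = 1. If t(i) = 1, take a neighbour m of i: either s(m) = 1, or t(i) is cancelled
in s(m) by some other t(j) = 1. Two such blocks give weight at least 6. The bound
4 is reached by the closed neighbourhood of a vertex of degree 3: offset 6 over A,
offset 3 elsewhere. *)

(** * Binary scalars and enumerations *)

Section BinaryField.
Local Open Scope ring_scope.

Lemma F2_cases (x : 'F_2) : x = 0 \/ x = 1.
Proof.
by case: x => [[|[|]]] // i; [left | right]; apply/val_inj.
Qed.

Lemma oppr_F2 (x : 'F_2) : - x = x.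
Proof. exact/oppr_pchar2/pchar_Fp. Qed.

End BinaryField.

Lemma map_enum_val (T : finType) (A : {set T}) :
  [seq enum_val i | i <- enum 'I_#|A|] = enum A.
Proof.
case: (pickP (mem A)) => [x0 _|A0]; last first.
  have cA0 : #|A| = 0 by apply: eq_card0.
  apply: etrans (size0nil _) (esym (size0nil _)).
    by rewrite size_map size_enum_ord.
  by rewrite -cardE.
rewrite (eq_map (enum_val_nth x0)) (map_comp (nth x0 (enum A)) val).
by rewrite val_enum_ord map_nth_iota0 cardE // take_size.
Qed.

(** * The code of one side of a bipartite graph *)

Section GraphCode.
Set Implicit Arguments.
Unset Strict Implicit.
Local Open Scope ring_scope.
Variables (n : nat) (H : sgraph 'I_n).
Implicit Types (X : {set 'I_n}) (x y z : 'I_n) (w : 'rV['F_2]_n).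

Definition nbhd_word x : 'rV['F_2]_n := \row_z ((x == z) || H x z)%:R.

Definition graph_code X : {vspace 'rV['F_2]_n} :=
  <<[seq nbhd_word x | x <- enum X]>>%VS.

(** On the coordinates in X the generators are unit vectors: this is the block I
of the generator matrix (I | P). *)
Lemma nbhd_word_independent X x z : independent H X -> x \in X -> z \in X ->
  nbhd_word x 0 z = (x == z)%:R.
Proof. by move=> indX xX zX; rewrite mxE (negbTE (indX _ _ xX zX)) orbF. Qed.

Lemma nbhd_word_in X x : x \in X -> nbhd_word x \in graph_code X.
Proof. by move=> xX; apply/memv_span/map_f; rewrite mem_enum. Qed.

Lemma nbhd_words_free X : independent H X ->
  free [seq nbhd_word x | x <- enum X].
Proof.
move=> indX.
have sz : size [seq nbhd_word x | x <- enum X] == #|X| by rewrite size_map -cardE.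
apply/(@freeP _ _ _ (Tuple sz)) => c sum0 i.
have xiX := enum_valP i.
have /matrixP/(_ 0 (enum_val i)) := sum0; rewrite mxE summxE => <-.
rewrite (bigD1 i) //= big1 ?addr0 => [|j ji].
  rewrite (nth_map (enum_val i)) -?cardE // -enum_val_nth mxE.
  by rewrite (nbhd_word_independent indX) // eqxx mulr1.
rewrite (nth_map (enum_val i)) -?cardE // -enum_val_nth mxE.
rewrite (nbhd_word_independent indX) ?enum_valP //.
by rewrite (inj_eq enum_val_inj) (negbTE ji) mulr0.
Qed.

Lemma graph_code_basis X : independent H X ->
  basis_of (graph_code X) [seq nbhd_word x | x <- enum X].
Proof. by move=> indX; rewrite basisEfree nbhd_words_free // subvv dim_span. Qed.

Lemma graph_code_sum X w : w \in graph_code X ->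
  exists c : 'I_n -> 'F_2, w = \sum_(x in X) c x *: nbhd_word x.
Proof.
rewrite /graph_code span_def big_map big_enum => /memv_sumP[vs vsP ->].
have [|c cP] := @fin_all_exists _ (fun=> 'F_2)
    (fun x b => x \in X -> vs x = b *: nbhd_word x).
  move=> x; case: (boolP (x \in X)) => [/vsP/vlineP[b ->]|_]; last by exists 0.
  by exists b.
by exists c; apply: eq_bigr.
Qed.

Lemma dim_graph_code X : independent H X -> \dim (graph_code X) = #|X|.
Proof.
by move=> /nbhd_words_free /eqP ->; rewrite size_map -cardE.
Qed.

Section Bipartition.
Variable X : {set 'I_n}.
Hypotheses (indX : independent H X) (indCX : independent H (~: X)).

Lemma bip_nbr x y : H x y -> (x \in X) = (y \notin X).
Proof.
move=> xy; apply/idP/idP => [xX|yX].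
  by apply/negP => yX; move: (indX xX yX); rewrite xy.
apply/negPn/negP => xX.
by have := indCX (x := x) (y := y); rewrite !inE xy => /(_ xX yX).
Qed.

(** The vertices outside X index the rows of a parity-check matrix, again made of
closed neighbourhoods: since y is the only vertex of ~: X in its own closed
neighbourhood, each check determines the bit w(y) from the bits in X. *)
Lemma graph_codeP w :
  reflect (forall y, y \notin X -> w 0 y = \sum_(z | H z y) w 0 z)
          (w \in graph_code X).
Proof.
pose checked (v : 'rV['F_2]_n) := forall y, y \notin X -> v 0 y = \sum_(z | H z y) v 0 z.
have checked_nbhd x : x \in X -> checked (nbhd_word x).
  move=> xX y yX; rewrite mxE.
  have -> : x == y = false by apply: contraNF yX => /eqP <-.
  rewrite /= big_mkcond (bigD1 x) //= big1 ?addr0 => [|z zx].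
    by rewrite mxE eqxx; case: ifP.
  case: ifP => // zy; rewrite (nbhd_word_independent indX) ?(bip_nbr zy) //.
  by rewrite eq_sym (negbTE zx).
apply: (iffP idP) => [wC|chk].
  have [c ->] := graph_code_sum wC.
  move=> y yX; rewrite summxE; under [RHS]eq_bigr do rewrite summxE.
  rewrite [RHS]exchange_big; apply: eq_bigr => x xX.
  rewrite mxE; under [RHS]eq_bigr do rewrite mxE.
  by rewrite -mulr_sumr (checked_nbhd x xX).
(* The bits in X are the coordinates of w in the basis of closed neighbourhoods,
   and the checks determine the other bits from them. *)
have -> : w = \sum_(x in X) w 0 x *: nbhd_word x.
  apply/rowP=> z; rewrite summxE; case: (boolP (z \in X)) => zX.
    rewrite (bigD1 z) //= big1 ?addr0 => [|x /andP[xX xz]].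
      by rewrite mxE (nbhd_word_independent indX) // eqxx mulr1.
    by rewrite mxE (nbhd_word_independent indX) // (negbTE xz) mulr0.
  rewrite chk // [LHS]big_mkcond [RHS]big_mkcond; apply: eq_bigr => x _ /=.
  rewrite mxE mxE; case: ifP => xz; first by rewrite (bip_nbr xz) zX orbT mulr1.
  case: ifP => // xX; rewrite orbF.
  by rewrite (_ : x == z = false) ?mulr0 //; apply: contraNF zX => /eqP <-.
by apply: memv_suml => x xX; apply/memvZ/nbhd_word_in.
Qed.

End Bipartition.

Lemma nbhd_word_dot w x : w *m (nbhd_word x)^T = (w 0 x + \sum_(z | H z x) w 0 z)%:M.
Proof.
apply/matrixP=> i j; rewrite !ord1 !mxE mulr1n (bigD1 x) //= !mxE eqxx mulr1.
apply: congr1; rewrite [LHS]big_mkcond [RHS]big_mkcond; apply: eq_bigr => z _ /=.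
rewrite !mxE edge_sym eq_sym; case: eqVneq => [->|_] /=; first by rewrite edge_irr.
by case: (H z x); rewrite ?mulr1 ?mulr0.
Qed.

(** Orthogonality to the generator of x in X is the parity check at x of the code
of ~: X. *)
Lemma dual_graph_code X : independent H X -> independent H (~: X) ->
  dual_code (graph_code X) = graph_code (~: X).
Proof.
move=> indX indCX; apply/vspaceP => w.
have indCCX : independent H (~: ~: X) by rewrite setCK.
have dotP x : (w *m (nbhd_word x)^T == 0) = (w 0 x == \sum_(z | H z x) w 0 z).
  rewrite nbhd_word_dot -[RHS]subr_eq0 oppr_F2; apply/eqP/eqP => [/matrixP/(_ 0 0)|->].
    by rewrite !mxE.
  by rewrite raddf0.
apply/mem_dual_code/(graph_codeP indCX indCCX) => [dw x|dw v vC].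
  by rewrite inE negbK => xX; apply/eqP; rewrite -dotP; apply/eqP/dw/nbhd_word_in.
have [c ->] := graph_code_sum vC.
rewrite raddf_sum mulmx_sumr big1 // => x xX.
rewrite /= linearZ /= -scalemxAr.
have /eqP -> : w *m (nbhd_word x)^T == 0; last by rewrite scaler0.
by rewrite dotP; apply/eqP/dw; rewrite inE negbK.
Qed.

(** The coordinates are permuted so that X comes first, each side in the order of
its enumeration; the closed neighbourhoods of X then become the rows of (I | P),
with P the adjacency matrix between the two sides. *)
Lemma graph_code_corresponds X : independent H X -> independent H (~: X) ->
  corresponds H (graph_code X).
Proof.
move=> indX indCX.
have kmn : (#|X| + #|~: X|)%N = n by rewrite cardsC card_ord.
pose g (i : 'I_(#|X| + #|~: X|)) : 'I_n :=
  match split i with inl a => enum_val a | inr b => enum_val b end.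
have gl a : g (lshift _ a) = enum_val a by rewrite /g (unsplitK (inl _ a)).
have gr b : g (rshift _ b) = enum_val b by rewrite /g (unsplitK (inr _ b)).
have g_inj : injective g.
  move=> i j; rewrite -(splitK i) -(splitK j).
  case: (split i) (split j) => [a|b] [a'|b'] /=; rewrite ?gl ?gr.
  - by move/enum_val_inj->.
  - by move=> e; have := enum_valP b'; rewrite -e inE enum_valP.
  - by move=> e; have := enum_valP b; rewrite e inE enum_valP.
  - by move/enum_val_inj->.
have g_bij : bijective g by apply: inj_card_bij => //; rewrite !card_ord kmn.
have s_inj : injective (g \o cast_ord (esym kmn)) by apply/inj_comp/cast_ord_inj.
pose s := perm s_inj.
(* The permuted code is taken as an image under an injective linear map, so that
   the basis of closed neighbourhoods is transported to it. *)
pose f := linfun (col_perm s : 'rV['F_2]_n -> _).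
have f_inj : lker f == 0%VS.
  apply/lker0P => u v; rewrite !lfunE /= => /(congr1 (col_perm s^-1)).
  by rewrite -!col_permM mulVg !col_perm1.
pose P := \matrix_(a < #|X|, b < #|~: X|) (H (enum_val a) (enum_val b))%:R : 'M['F_2]_(_,_).
exists #|X|, #|~: X|, kmn, P, (f @: graph_code X)%VS; split.
- exists s => w; have -> : col_perm s w = f w by rewrite lfunE.
  by rewrite memvE memvE -limg_line limg_ker0.
- have := limg_basis_of _ (graph_code_basis indX) => /(_ _ f).
  rewrite (eqP f_inj) capv0 => /(_ erefl).
  rewrite /generator_matrix; congr basis_of.
  rewrite -{1}map_enum_val -!map_comp; apply: eq_map => i /=.
  rewrite lfunE /=; apply/rowP => z; rewrite !mxE permE /= castmxE /= cast_ord_id.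
  rewrite -(splitK (cast_ord _ z)); case: (split _) => [a|b] /=.
    rewrite gl row_mxEl mxE (negbTE (indX _ _ (enum_valP _) (enum_valP _))).
    by rewrite orbF (inj_eq enum_val_inj).
  rewrite gr row_mxEr mxE; case: eqVneq => // e.
  by have := enum_valP b; rewrite -e inE enum_valP.
have [h gK hK] := g_bij.
exists h; first by exists g.
move=> x y; rewrite -{2}(hK x) -{2}(hK y).
rewrite /= /bip_rel.
rewrite -(splitK (h x)) -(splitK (h y)).
case: (split (h x)) (split (h y)) => [a|b] [a'|b'] /=; rewrite ?gl ?gr.
- by rewrite block_mxEul mxE (negbTE (indX _ _ (enum_valP _) (enum_valP _))).
- by rewrite block_mxEur mxE; case: (H _ _).
- by rewrite block_mxEdl !mxE edge_sym; case: (H _ _).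
- by rewrite block_mxEdr mxE (negbTE (indCX _ _ (enum_valP _) (enum_valP _))).
Qed.

Lemma min_distanceP (C : {vspace 'rV['F_2]_n}) d :
  (exists w, [/\ w \in C, w != 0 & hdist w 0 = d]) ->
  (forall w, w \in C -> w != 0 -> (d <= hdist w 0)%N) ->
  min_distance C d.
Proof.
move=> [w [wC w0 wd]] ge_d; split; first by exists w, 0; rewrite mem0v.
move=> x y xC yC xy; have := ge_d (x - y); rewrite memvB // subr_eq0 => /(_ isT xy).
congr (d <= _)%N; apply: eq_card => i; rewrite !inE !mxE.
by rewrite subr_eq0.
Qed.

End GraphCode.

(** * Weights inside one block *)

Section HammingBlocks.
Set Implicit Arguments.
Unset Strict Implicit.
Local Open Scope ring_scope.

Definition offset_range : seq nat := [:: 0; 1; 2; 3; 4; 5; 6]%N.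

Definition block_weight (v : nat -> 'F_2) : nat :=
  count (fun a => v a != 0) offset_range.

Definition block_check (v : nat -> 'F_2) (b : nat) : 'F_2 :=
  \sum_(a <- offset_range | h_rel a b) v a.

(** The three checks cut out the [7,4,3] Hamming code. They add up to
v 3 + v 4 + v 5 + v 6 = 0, so p is also the parity of the weight of v: a word of
weight 3 has p = 1. *)
Lemma hamming_block_weight (v : nat -> 'F_2) (p := v 0%N + v 1%N + v 2%N) :
  (forall b, b \in [:: 3; 4; 5]%N -> v b = block_check v b) ->
  (p != 0 -> (3 <= block_weight v)%N) /\
  (p = 0 -> (0 < block_weight v)%N -> (4 <= block_weight v)%N).
Proof.
move=> chk; rewrite /p.
have := chk 3%N isT; have := chk 4%N isT; have := chk 5%N isT.
rewrite /block_check !big_cons !big_nil /= /block_weight /=.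
move=> -> -> ->.
by case: (F2_cases (v 0%N)) => ->; case: (F2_cases (v 1%N)) => ->;
   case: (F2_cases (v 2%N)) => ->; case: (F2_cases (v 6%N)) => ->;
   split=> // /eqP.
Qed.

(** For p = 0 these are the checks of the [7,3,4] simplex code; for p = 1 they define
its coset by the word 1110000, all of whose words have weight 3 or 7. *)
Lemma simplex_block_weight (v : nat -> 'F_2) (p : 'F_2) :
  (forall b, b \in [:: 0; 1; 2; 6]%N ->
     v b = block_check v b + (if (b < 3)%N then p else 0)) ->
  (p != 0 -> (3 <= block_weight v)%N) /\
  (p = 0 -> (0 < block_weight v)%N -> (4 <= block_weight v)%N).
Proof.
move=> chk.
have := chk 0%N isT; have := chk 1%N isT; have := chk 2%N isT; have := chk 6%N isT.
rewrite /block_check !big_cons !big_nil /= /block_weight /=.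
move=> -> -> -> ->.
by case: (F2_cases (v 3%N)) => ->; case: (F2_cases (v 4%N)) => ->;
   case: (F2_cases (v 5%N)) => ->; case: (F2_cases p) => ->;
   split=> // /eqP.
Qed.

End HammingBlocks.

(** * The code of the Hamming expansion *)

Section HammingExpansionCode.
Set Implicit Arguments.
Unset Strict Implicit.
Local Open Scope ring_scope.
Variables (k : nat) (G : sgraph 'I_k).
Local Notation HG := (hamming_expansion G).
Implicit Types (A : {set 'I_k}) (i j : 'I_k) (w : 'rV['F_2]_(7 * k)).

Lemma vtx_subproof (i : 'I_k) (a : nat) : (7 * i + a %% 7 < 7 * k)%N.
Proof.
apply: (@leq_trans (7 * i.+1)%N); last by rewrite leq_mul2l ltn_ord.
by rewrite mulnS addnC ltn_add2r ltn_pmod.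
Qed.

(** Offsets are reduced modulo 7 so that [vtx] is total on natural numbers, and a
sum over the seven literal offsets can be unrolled by computation. *)
Definition vtx (i : 'I_k) (a : nat) : 'I_(7 * k) := Ordinal (vtx_subproof i a).

Lemma block_vtx i a : block (vtx i a) = i.
Proof.
by apply/val_inj; rewrite /= mulnC divnMDl // divn_small ?addn0 ?ltn_pmod.
Qed.

Lemma offset_vtx i a : offset (vtx i a) = (a %% 7)%N.
Proof. by rewrite /offset /= mulnC modnMDl modn_mod. Qed.

Lemma vtxK z : vtx (block z) (offset z) = z.
Proof. by apply/val_inj; rewrite /= /offset modn_mod mulnC -divn_eq. Qed.

Lemma offset_range_ltn a : (a \in offset_range) = (a < 7)%N.
Proof. by rewrite (_ : offset_range = iota 0 7) // mem_iota. Qed.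

Lemma big_vtx (R : Type) (idx : R) (op : Monoid.com_law idx)
    (F : 'I_(7 * k) -> R) :
  \big[op/idx]_z F z = \big[op/idx]_i \big[op/idx]_(a <- offset_range) F (vtx i a).
Proof.
pose f (p : 'I_k * 'I_7) := vtx p.1 p.2.
have f_bij : bijective f.
  exists (fun z => (block z, inord (offset z))) => [[i a]|z]; rewrite /f /=.
    by rewrite block_vtx offset_vtx modn_small // inord_val.
  by rewrite inordK ?vtxK // ltn_pmod.
rewrite (reindex f) /=; last exact: onW_bij.
rewrite -(pair_bigA_idem _ (fun i (a : 'I_7) => F (vtx i a))) //.
  apply: eq_bigr => i _.
  exact: esym (big_mkord xpredT (fun a => F (vtx i a))).
exact: Monoid.mulm1.
Qed.

Definition bit (w : 'rV['F_2]_(7 * k)) (i : 'I_k) (a : nat) : 'F_2 := w 0 (vtx i a).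

Lemma hdist_blocks w : hdist w 0 = (\sum_i block_weight (bit w i))%N.
Proof.
rewrite /hdist -sum1_card big_mkcond big_vtx; apply: eq_bigr => i _.
rewrite /block_weight -sum1_count [RHS]big_mkcond; apply: eq_bigr => a _.
by rewrite !inE mxE.
Qed.

Lemma hamming_vtx i j a b : (a < 7)%N -> (b < 7)%N ->
  HG (vtx i a) (vtx j b) =
  if i == j then h_rel a b else [&& G i j, (a < 3)%N & (b < 3)%N].
Proof.
by move=> a7 b7; rewrite /= /hamming_rel !block_vtx !offset_vtx !modn_small.
Qed.

Definition parity w i : 'F_2 := bit w i 0 + bit w i 1 + bit w i 2.

(** Another block is joined to [vtx i b] by all of its offsets 0, 1, 2 or by none,
and therefore contributes its parity. *)
Lemma sum_neighbours w i b : (b < 7)%N ->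
  \sum_(z | HG z (vtx i b)) w 0 z =
  block_check (bit w i) b +
  (if (b < 3)%N then \sum_(j | G j i) parity w j else 0).
Proof.
move=> b7; rewrite big_mkcond big_vtx (bigD1 i) //; congr (_ + _).
  rewrite /block_check [RHS]big_mkcond; apply: eq_big_seq => a.
  by rewrite offset_range_ltn => a7; rewrite hamming_vtx // eqxx.
transitivity (\sum_(j | j != i) if G j i && (b < 3)%N then parity w j else 0).
  apply: eq_bigr => j ji; rewrite /parity /bit !big_cons big_nil.
  rewrite !hamming_vtx // (negbTE ji) /= !andbF !addr0.
  by case: ifP => _; rewrite ?addr0 ?addrA.
case: ifP => _; last by rewrite big1 // => j _; rewrite andbF.
rewrite [LHS]big_mkcond [RHS]big_mkcond; apply: eq_bigr => j _.
by rewrite andbT; case: eqVneq => // ->; rewrite edge_irr.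
Qed.

(** The side of the expansion that contains w_(7i), w_(7i+1), w_(7i+2) exactly for
the i in A. *)
Definition hside (A : {set 'I_k}) : {set 'I_(7 * k)} :=
  [set z | (block z \in A) == (offset z \in [:: 0; 1; 2; 6]%N)].

Lemma vtx_hside A i a : (a < 7)%N ->
  (vtx i a \in hside A) = ((i \in A) == (a \in [:: 0; 1; 2; 6]%N)).
Proof. by move=> a7; rewrite inE block_vtx offset_vtx modn_small. Qed.

Lemma setC_hside A : ~: hside A = hside (~: A).
Proof.
by apply/setP => z; rewrite !inE; case: (_ \in A); case: (_ || _).
Qed.

Lemma card_hside A : #|hside A| = (4 * #|A| + 3 * #|~: A|)%N.
Proof.
rewrite -sum1_card big_mkcond big_vtx (bigID (mem A)) /=.
rewrite [(4 * _)%N]mulnC [(3 * _)%N]mulnC.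
rewrite -!sum_nat_const; congr (_ + _)%N.
  by apply: eq_bigr => i iA; rewrite !big_cons big_nil !vtx_hside // iA.
apply: eq_big => i; first by rewrite inE.
by move=> iA; rewrite !big_cons big_nil !vtx_hside // (negbTE iA).
Qed.

(** Edges between different blocks only join offsets below 3, where membership in
[hside A] means that the block is over A. *)
Lemma hside_independent A : independent G A -> independent HG (hside A).
Proof.
move=> indA x y; rewrite !inE /= /hamming_rel => /eqP bx /eqP by_.
case: eqP => [exy|_].
  move: bx by_; rewrite exy => -> .
  have := ltn_pmod x (isT : 0 < 7)%N; have := ltn_pmod y (isT : 0 < 7)%N.
  rewrite -/(offset x) -/(offset y).
  by case: (offset x) => [|[|[|[|[|[|[|]]]]]]]; case: (offset y) => [|[|[|[|[|[|[|]]]]]]].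
apply/negP => /and3P[gxy ox oy].
have small c : (c < 3)%N -> [|| c == 0, c == 1, c == 2 | c == 6]%N by case: c => [|[|[|]]].
by move/negP: (indA _ _ (etrans bx (small _ ox)) (etrans by_ (small _ oy))).
Qed.

(** In every block one of the vertices of degree 3, whose neighbours all lie in the
same block, belongs to [hside A]: offset 6 over A, offset 3 elsewhere. *)
Lemma hamming_code_weight4 A (i : 'I_k) :
  exists w, [/\ w \in graph_code HG (hside A), w != 0 & hdist w 0 = 4%N].
Proof.
pose c := if i \in A then 6%N else 3%N.
have c7 : (c < 7)%N by rewrite /c; case: ifP.
have c3 : (c < 3)%N = false by rewrite /c; case: ifP.
have wt4 : hdist (nbhd_word HG (vtx i c)) 0 = 4%N.
  have bitE j a : (a < 7)%N -> bit (nbhd_word HG (vtx i c)) j a =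
      ((i == j) && ((c == a) || h_rel c a))%:R.
    move=> a7; rewrite /bit mxE hamming_vtx // c3 andbF.
    have -> : (vtx i c == vtx j a) = (i == j) && (c == a).
      apply/eqP/andP => [e|[/eqP-> /eqP->] //].
      move: (congr1 (@block _) e) (congr1 (@offset _) e).
      by rewrite !block_vtx !offset_vtx !modn_small // => -> ->.
    by case: (i == j).
  rewrite hdist_blocks (bigD1 i) //= big1 => [|j ji].
    by rewrite /block_weight /= !bitE // eqxx /c; case: ifP.
  by rewrite /block_weight /= !bitE // [i == j]eq_sym (negbTE ji).
exists (nbhd_word HG (vtx i c)); split=> //.
  by apply: nbhd_word_in; rewrite vtx_hside // /c; case: ifP.
apply: contra_eq_neq wt4 => ->.
rewrite (_ : hdist _ _ = 0%N) //; apply: eq_card0 => z.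
by rewrite !inE eqxx.
Qed.

(** Every nonzero block weighs at least 4, except possibly those with a nonzero
parity p, which weigh at least 3; the latter never occur alone because no vertex
of G is isolated. *)
Lemma hamming_code_weight A w :
  independent G A -> independent G (~: A) ->
  (forall i, exists j, G i j) ->
  w \in graph_code HG (hside A) -> w != 0 -> (4 <= hdist w 0)%N.
Proof.
move=> indA indCA nonisolated wC w0.
have checks i b : (b < 7)%N -> vtx i b \notin hside A ->
    bit w i b = block_check (bit w i) b +
      (if (b < 3)%N then \sum_(j | G j i) parity w j else 0).
  move=> b7 bX; rewrite -sum_neighbours //.
  apply: (graph_codeP _ _ _ wC) bX; first exact: hside_independent.
  by rewrite setC_hside; apply: hside_independent.
pose p i := if i \in A then parity w i else \sum_(j | G j i) parity w j.
have weight i : (p i != 0 -> (3 <= block_weight (bit w i))%N) /\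
    (p i = 0 -> (0 < block_weight (bit w i))%N -> (4 <= block_weight (bit w i))%N).
  rewrite /p; case: ifP => iA.
    apply: hamming_block_weight => b; rewrite !inE => bY.
    have /andP[b7 b3] : (b < 7)%N && (b >= 3)%N by case/or3P: bY => /eqP->.
    have bX : vtx i b \notin hside A.
      by rewrite vtx_hside // iA; case/or3P: bY => /eqP->.
    by rewrite checks // ltnNge b3 addr0.
  apply: simplex_block_weight => b bY.
  have b7 : (b < 7)%N by move: bY; rewrite !inE => /or4P[] /eqP->.
  by apply: checks => //; rewrite vtx_hside // iA bY.
have ge_block i : (block_weight (bit w i) <= hdist w 0)%N.
  by rewrite hdist_blocks (bigD1 i) //= leq_addr.
case: (pickP (fun i => p i != 0)) => [i pi|p0]; last first.
  have [i wi] : exists i, (0 < block_weight (bit w i))%N.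
    apply/existsP; apply: contraNT w0; rewrite negb_exists => /forallP w0.
    apply/eqP/rowP => z; rewrite mxE -(vtxK z) -/(bit w _ _).
    have := w0 (block z); rewrite -has_count => /hasPn/(_ (offset z)).
    by rewrite offset_range_ltn ltn_pmod // negbK => /(_ isT)/eqP.
  by apply: leq_trans (ge_block i); apply: (weight i).2 => //; move/eqP: (p0 i).
(* A second block with nonzero p: a neighbour of i if i is outside A; otherwise,
   for a neighbour m of i, either m itself or a block cancelling p i in p m. *)
have [j ji pj] : exists2 j, j != i & p j != 0.
  have sum_neq0 m : m \notin A -> p m != 0 -> exists2 j, G j m & p j != 0.
    move=> mA; rewrite /p (negbTE mA) => sm.
    have /existsP[j /andP[jm pj]] : [exists j, G j m && (parity w j != 0)].
      apply: contraNT sm; rewrite negb_exists => /forallP sm.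
      rewrite big1 // => j jm; move: (sm j); rewrite jm /= negbK.
      by move/eqP.
    exists j => //; suff -> : j \in A by [].
    by apply/negPn/negP => jA; have := indCA j m; rewrite !inE jm => /(_ jA mA).
  case: (boolP (i \in A)) => iA; last first.
    have [j jm pj] := sum_neq0 i iA pi; exists j => //.
    by apply: contraTneq jm => ->; rewrite edge_irr.
  have [m im] := nonisolated i.
  have mA : m \notin A by apply/negP => mA; have := indA i m iA mA; rewrite im.
  case: (eqVneq (p m) 0) => [pm|pm]; last first.
    by exists m => //; apply: contraNneq mA => ->.
  have /existsP[j /andP[ji pj]] : [exists j, (j != i) && (p j != 0)].
    apply: contraTT isT; rewrite negb_exists => /forallP pj.
    move: pm; rewrite /p (negbTE mA) (bigD1 i im) /= big1 ?addr0 => [pi0|j /andP[jm ji]].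
      by move: pi; rewrite /p iA pi0 eqxx.
    have jA : j \in A.
      by apply/negPn/negP => jA; have := indCA j m; rewrite !inE jm => /(_ jA mA).
    by move: (pj j); rewrite ji /p jA /= negbK => /eqP.
  by exists j.
rewrite hdist_blocks (bigD1 i) //= (bigD1 j) //= addnA.
apply: leq_trans (leq_addr _ _).
exact: leq_trans (leq_add ((weight i).1 pi) ((weight j).1 pj)).
Qed.

(** Stated for either side of G: at ~: A it describes the dual code. *)
Lemma hamming_code A (i0 : 'I_k) :
  independent G A -> independent G (~: A) ->
  (forall i, exists j, G i j) ->
  let C := graph_code HG (hside A) in
  is_code C (4 * #|A| + 3 * #|~: A|)%N 4 /\ corresponds HG C.
Proof.
move=> indA indCA nonisolated C.
have indX := hside_independent indA; have indCX := hside_independent indCA.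
split; last by apply: graph_code_corresponds; rewrite ?setC_hside.
split; first by rewrite dim_graph_code // card_hside.
apply: min_distanceP; first exact: hamming_code_weight4.
by move=> w; apply: hamming_code_weight.
Qed.

End HammingExpansionCode.

Lemma connected_has_neighbour (T : finType) (G : sgraph T) (x y : T) :
  connected_graph G -> x != y -> exists z, G x z.
Proof.
move=> conG; case/connectP: (conG x y) => [[|z p] /= pth ->]; first by rewrite eqxx.
by exists z; case/andP: pth.
Qed.

Theorem theorem11 (k r : nat) (G : sgraph 'I_k) :
  2 <= k ->
  connected_graph G ->
  elc_preserved G ->
  bipartite G r (k - r) ->
  exists C : {vspace 'rV['F_2]_(7 * k)},
    [/\ is_code C (3 * k + r) 4,
        is_code (dual_code C) (4 * k - r) 4,
        corresponds (hamming_expansion G) C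
      & corresponds (hamming_expansion G) (dual_code C)].
Proof.
move=> k2 conG _ [A [cardA cardCA indA indCA]].
have rk : r <= k by rewrite -cardA -[k in _ <= k]card_ord max_card.
have i0 : 'I_k by apply: Ordinal k2.
have nonisolated i : exists j, G i j.
  have [j ij] : exists j, i != j.
    apply/existsP; apply: contraLR k2; rewrite negb_exists => /forallP same.
    rewrite -leqNgt -(card_ord k); apply/fintype_le1P => x y.
    by move: (same x) (same y); rewrite !negbK => /eqP <- /eqP.
  exact: connected_has_neighbour conG ij.
have indCCA : independent G (~: ~: A) by rewrite setCK.
exists (graph_code (hamming_expansion G) (hside A)).
rewrite dual_graph_code ?setC_hside; try exact: hside_independent.
have [code corr] := hamming_code i0 indA indCA nonisolated.
have [dcode dcorr] := hamming_code i0 indCA indCCA nonisolated.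
split=> //.
  suff <- : 4 * #|A| + 3 * #|~: A| = 3 * k + r by [].
  by rewrite cardA cardCA; lia.
suff <- : 4 * #|~: A| + 3 * #|~: ~: A| = 4 * k - r by [].
by rewrite setCK cardA cardCA; lia.
Qed.
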